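(* Let $n,a\ge 1$ and fix integers $r_1,\dots,r_a\ge 0$ with $\sum_{i=1}^a r_i=n$. The Gessel–Reutenauer map $U$ defines by restriction a cycle-structure preserving bijection $\bar U$ from the set of elements of $S_n$ with descent set contained in $\{r_1,\,r_1+r_2,\dots,r_1+\cdots+r_a=n\}$ onto the set of multisets of primitive necklaces on the alphabet $\{1,\dots,a\}$ formed from a total of $r_i$ letters $i$ for each $i$. Precisely: for each such permutation $\pi$ there is a unique word $w$ of length $n$ containing exactly $r_i$ letters $i$ for each $i$ with $st(w)=\pi^{-1}$; one sets $\bar U(\pi)=U(w)$; and $\bar U$ is a bijection such that, for every $j\ge1$, the number of $j$-cycles of $\pi$ equals the number (with multiplicity) of necklaces of length $j$ in $\bar U(\pi)$.
   Context: Descents: $\pi\in S_n$ has a descent at position $i$ ($1\le i\le n-1$) if $\pi(i)>\pi(i+1)$; by convention every $\pi\in S_n$ also has a descent at position $n$. The descent set of $\pi$ is the set of positions at which it has a descent. A necklace is a finite nonempty sequence of letters arranged cyclically (a word up to cyclic rotation); its length is its number of letters. It is primitive if it is not equal to any of its non-trivial cyclic shifts (e.g. $(a\,a\,b\,b)$ is primitive, $(a\,b\,a\,b)$ is not). For a word $w=w_1\cdots w_n$ on an ordered alphabet, the standard permutation $st(w)\in S_n$ is the permutation ranking the letters of $w$, ties being broken by regarding the letter further to the left as smaller: $st(w)(i)=\#\{j: w_j<w_i\}+\#\{j\le i: w_j=w_i\}$. The map $U$: given $w$, take the cycles of $st(w)$ and replace each number $i$ in each cycle by the letter $w_i$, obtaining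 a multiset $U(w)$ of necklaces, one per cycle. Cycles are read in the order $(i,\sigma(i),\sigma^2(i),\dots)$ with $\sigma=st(w)^{-1}$. *)

(* Defs.v *)
From HB Require Import structures.
From mathcomp Require Import all_boot all_order all_fingroup.
From mathcomp Require Import generic_quotient finmap multiset.

Set Implicit Arguments.
Unset Strict Implicit.
Unset Printing Implicit Defensive.

Import Order.TTheory.

Local Open Scope nat_scope.
Local Open Scope quotient_scope.
Local Open Scope mset_scope.

(* Mathematical positions 1, ..., n are represented by 'I_n, and letters
   1, ..., a by 'I_a, both shifted down by one.  Descent positions, partial
   sums and lengths are not shifted. *)

Section Necklace.
Variable T : choiceType.

Definition nword := {u : seq T | 0 < size u}.

Definition rot_equiv (u v : nword) : bool :=
  [exists k : 'I_(size (val u)), rot k (val u) == val v].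

Lemma rot_equivP (u v : nword) :
  reflect (exists k, rot k (val u) = val v) (rot_equiv u v).
Proof.
apply: (iffP existsP) => [[k /eqP kP]|[k kP]]; first by exists k.
case: (ltnP k (size (val u))) => [lt_k | le_k].
  by exists (Ordinal lt_k); rewrite kP.
by exists (Ordinal (valP u)); rewrite rot0 -kP rot_oversize.
Qed.

Lemma rot_equiv_refl : reflexive rot_equiv.
Proof. by move=> u; apply/rot_equivP; exists 0; rewrite rot0. Qed.

Lemma rot_equiv_sym : symmetric rot_equiv.
Proof.
suff H u v : rot_equiv u v -> rot_equiv v u by move=> u v; apply/idP/idP => /H.
case/rot_equivP => k kP; apply/rot_equivP.
by exists (size (val v) - k); rewrite -kP; apply: rotK.
Qed.

Lemma rot_equiv_trans : transitive rot_equiv.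
Proof.
move=> v u w /rot_equivP[k kP] /rot_equivP[l lP]; apply/rot_equivP.
by exists (rot_add (val u) k l); rewrite -rot_rot_add kP.
Qed.

Canonical rot_equiv_rel :=
  EquivRel rot_equiv rot_equiv_refl rot_equiv_sym rot_equiv_trans.

Definition necklace := {eq_quot rot_equiv_rel}.
HB.instance Definition _ := Choice.on necklace.
HB.instance Definition _ := EqQuotient.on necklace.

Definition word_primitive (u : seq T) : bool :=
  [forall k : 'I_(size u), (0 < k) ==> (rot k u != u)].

(* The next three notions do not depend on the word chosen in the class:
   see necklace_sizeE, necklace_countE and necklace_primitiveE. *)
Definition necklace_size (x : necklace) : nat := size (val (repr x)).

Definition necklace_count (c : T) (x : necklace) : nat :=
  count_mem c (val (repr x)).

Definition necklace_primitive (x : necklace) : bool :=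
  word_primitive (val (repr x)).

Lemma necklaceP (u v : nword) :
  reflect (exists k, rot k (val u) = val v) (\pi_necklace u == \pi_necklace v).
Proof. by rewrite piE; apply: rot_equivP. Qed.

Lemma repr_necklace (u : nword) :
  exists k, val (repr (\pi_necklace u)) = rot k (val u).
Proof.
have /necklaceP[k kP] : \pi_necklace u == \pi_necklace (repr (\pi_necklace u)).
  by rewrite reprK.
by exists k.
Qed.

Lemma necklace_sizeE (u : nword) : necklace_size (\pi u) = size (val u).
Proof. by rewrite /necklace_size; have [k ->] := repr_necklace u; rewrite size_rot. Qed.

Lemma necklace_countE c (u : nword) :
  necklace_count c (\pi u) = count_mem c (val u).
Proof.
by rewrite /necklace_count; have [k ->] := repr_necklace u; apply/seq.permP; rewrite perm_rot.
Qed.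

Lemma necklace_primitiveE (u : nword) :
  necklace_primitive (\pi u) = word_primitive (val u).
Proof.
rewrite /necklace_primitive; have [k ->] := repr_necklace u.
rewrite /word_primitive; apply/forallP/forallP => H i.
  have lt_i : i < size (rot k (val u)) by rewrite size_rot.
  by have := H (Ordinal lt_i); rewrite /= rot_rot (inj_eq (@rot_inj _ _)).
have lt_i : i < size (val u) by apply: leq_trans (ltn_ord i) _; rewrite size_rot.
by have := H (Ordinal lt_i); rewrite rot_rot (inj_eq (@rot_inj _ _)).
Qed.

End Necklace.

Section Standardization.
Variables (d : Order.disp_t) (T : orderType d) (n : nat) (w : n.-tuple T).

Definition st_rank (i : 'I_n) : nat :=
  #|[set j : 'I_n | (tnth w j < tnth w i)%O]| +
  #|[set j : 'I_n | (j <= i) && (tnth w j == tnth w i)]|.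

Let below (i : 'I_n) : {set 'I_n} :=
  [set j | (tnth w j < tnth w i)%O || ((j <= i) && (tnth w j == tnth w i))].

Lemma st_rankE i : st_rank i = #|below i|.
Proof.
rewrite /st_rank -cardsUI; set A := [set j | _]; set B := [set j | _ & _].
have -> : A :&: B = set0.
  by apply/setP => j; rewrite !inE; case: ltgtP; rewrite ?andbF.
by rewrite cards0 addn0; congr #|pred_of_set _|; apply/setP => j; rewrite !inE.
Qed.

Lemma st_rank_gt0 i : 0 < st_rank i.
Proof. by rewrite st_rankE card_gt0; apply/set0Pn; exists i; rewrite inE leqnn eqxx orbT. Qed.

Lemma st_rank_le i : st_rank i <= n.
Proof. by rewrite st_rankE -[leqRHS]card_ord max_card. Qed.

Lemma st_rank_inj : injective st_rank.
Proof.
have belowS i j : j \in below i -> below j \subset below i.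
  rewrite inE => ji; apply/subsetP => k; rewrite !inE => kj.
  case/orP: ji => [ji | /andP[ji /eqP <-]].
    by case/orP: kj => [kj | /andP[_ /eqP ->]]; rewrite ?ji ?(lt_trans kj ji).
  by case/orP: kj => [-> // | /andP[kj ->]]; rewrite (leq_trans kj ji) orbT.
have below_refl i : i \in below i by rewrite inE leqnn eqxx orbT.
have below_total i j : (j \in below i) || (i \in below j).
  by rewrite !inE; case: ltgtP => //= _; rewrite ?andbT ?leq_total ?orbT.
have below_anti i j : j \in below i -> i \in below j -> i = j.
  rewrite !inE; case: ltgtP => //= _; rewrite ?andbT ?andbF // => ji ij.
  by apply/val_inj/eqP; rewrite eqn_leq ij ji.
move=> i j; rewrite !st_rankE => eq_ij.
wlog ji : i j eq_ij / j \in below i.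
  by case/orP: (below_total i j) => ji H; [|symmetry]; apply: H.
have /eqP eq_b : below j == below i by rewrite eqEcard belowS //= eq_ij.
by apply: below_anti => //; rewrite eq_b.
Qed.

Lemma st_fun_subproof i : (st_rank i).-1 < n.
Proof. by rewrite prednK ?st_rank_gt0 // st_rank_le. Qed.

Definition st_fun (i : 'I_n) : 'I_n := Ordinal (st_fun_subproof i).

Lemma st_fun_inj : injective st_fun.
Proof.
move=> i j /(congr1 (fun k : 'I_n => k.+1)) /=.
by rewrite !prednK ?st_rank_gt0 //; apply: st_rank_inj.
Qed.

Definition st : 'S_n := perm st_fun_inj.

Lemma stE i : (st i).+1 = st_rank i.
Proof. by rewrite permE /= prednK ?st_rank_gt0. Qed.

Let sigma : 'S_n := (st^-1)%g.

Definition cycle_word (i : 'I_n) : seq T :=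
  [seq tnth w k | k <- traject sigma i #|porbit sigma i|].

Lemma cycle_word_gt0 i : 0 < size (cycle_word i).
Proof. by rewrite size_map size_traject card_gt0; apply/set0Pn; exists i; apply: porbit_id. Qed.

Definition cycle_necklace (i : 'I_n) : necklace T :=
  \pi_(necklace T) (exist _ (cycle_word i) (cycle_word_gt0 i) : nword T).

Lemma cycle_necklace_perm i : cycle_necklace (sigma i) = cycle_necklace i.
Proof.
apply/esym/eqP/necklaceP; exists 1; rewrite /= /cycle_word -map_rot.
have -> : porbit sigma (sigma i) = porbit sigma i.
  by apply/eqP; rewrite eq_porbit_mem; apply: (mem_porbit sigma 1 i).
have := iter_porbit sigma i; case: #|_| => [|m] eq_i; first by [].
by rewrite [in RHS]trajectSr [in LHS]trajectS rot1_cons -iterSr eq_i.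
Qed.

(* cycle_necklace is constant on each cycle, so the choice made by [pick] in
   the next definition is immaterial. *)
Lemma cycle_necklace_porbit i j :
  j \in porbit sigma i -> cycle_necklace j = cycle_necklace i.
Proof.
case/porbitP => k ->; elim: k => [|k IHk]; first by rewrite expg0 perm1.
by rewrite expgSr permM cycle_necklace_perm.
Qed.

Definition U : {mset necklace T} :=
  seq_mset (pmap (fun C : {set 'I_n} => omap cycle_necklace [pick i in C])
                 (enum (porbits st))).

End Standardization.

Definition descent_set n (s : 'S_n) : {set 'I_n.+1} :=
  [set p : 'I_n.+1 | (p == n :> nat) ||
    [exists i : 'I_n, exists j : 'I_n,
       [&& i.+1 == p, j == p :> nat & s j < s i]]].

(* A partial sum equal to 0 may occur, but 0 is not a descent position
   when 0 < n. *)
Definition partial_sums n a (r : 'I_a -> nat) : {set 'I_n.+1} :=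
  [set p : 'I_n.+1 | [exists k : 'I_a, p == \sum_(c < a | c <= k) r c :> nat]].

Definition descent_perm n a (r : 'I_a -> nat) :=
  {s : 'S_n | descent_set s \subset partial_sums n r}.

Definition word_content n a (r : 'I_a -> nat) (w : n.-tuple 'I_a) : bool :=
  [forall c : 'I_a, count_mem c w == r c].

Definition primitive_multiset a (r : 'I_a -> nat) :=
  {M : {mset necklace 'I_a} |
    all (@necklace_primitive _) M &&
    [forall c : 'I_a, \sum_(x <- M) necklace_count c x == r c]}.

Definition num_cycles n (s : 'S_n) (j : nat) : nat :=
  #|[set C in porbits s | #|C| == j]|.

(* The coercion of M to a sequence repeats each element according to its
   multiplicity. *)
Definition num_necklaces (T : choiceType) (M : {mset necklace T}) (j : nat) : nat :=
  count (fun x => necklace_size x == j) M.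

(* Main.v *)
Require Import Defs.
From mathcomp Require Import all_boot all_order all_fingroup.
From mathcomp Require Import generic_quotient finmap multiset zify.

(** Attach to each position i the word orbit_key w i formed by the letters of w
along the orbit of i under sigma = (st w)^-1, read over a common multiple n! of
all cycle lengths.  Since i |-> w (sigma i) is weakly increasing, with ties
broken by sigma i itself, i |-> orbit_key w (sigma i) is weakly increasing for
the lexicographic order, and its last letter is w i.  On the other hand the
multiset of these words consists of the n!-periodic rotations of the necklaces
in U w.  Hence w is recovered from U w by sorting.  Conversely, for a multiset
of primitive necklaces, sort the n!-letter periodic rotations and let w be the
word of last letters: moving the last letter in front sorts the list stably by
w, so it becomes sorted again after reordering by sigma; thus sigma acts on the
list by rotation and U w is the given multiset.  Primitivity enters through the
fact that a periodic word determines its minimal period.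

On the side of permutations, the words w with st w = pi^-1 and content r are
those for which w \o pi is the increasing word of content r, and the places
where this word increases are partial sums of r. *)

Set Implicit Arguments.
Unset Strict Implicit.
Unset Printing Implicit Defensive.

Import Order.TTheory.

Local Open Scope nat_scope.
Local Open Scope quotient_scope.
Local Open Scope mset_scope.

(** * Periods of functions on the natural numbers *)

Section Periods.
Variables (T : Type) (f : nat -> T).

Definition period p := forall i, f (i + p) = f i.

Lemma period_muln p m : period p -> period (m * p).
Proof.
by move=> fp; elim: m => [|m IHm] i; rewrite ?addn0 // mulSn addnCA addnC fp.
Qed.

Lemma period_dvdn p q : p %| q -> period p -> period q.
Proof. by case/dvdnP => m ->; apply: period_muln. Qed.

Lemma period_modn p i : period p -> f (i %% p) = f i.
Proof. by move=> fp; rewrite [in RHS](divn_eq i p) addnC (period_muln _ fp). Qed.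

(** Bezout: a shift by [gcdn p q] followed by [kn] periods [q] amounts to [km] periods [p]. *)
Lemma period_gcdn p q : 0 < p -> period p -> period q -> period (gcdn p q).
Proof.
move=> p_gt0 fp fq i; case: (egcdnP q p_gt0) => km kn e _.
by rewrite -(period_muln kn fq) -addnA [_ + kn * q]addnC -e (period_muln km fp).
Qed.

End Periods.

(** * Periodic extensions of words and primitivity *)

Section PeriodicWords.
Variables (T : choiceType) (x0 : T).
Implicit Types (u v : seq T) (i j k : nat).

(** The infinite periodic word [u u u ...], constantly [x0] when [u] is empty. *)
Definition pword u i := nth x0 u (i %% size u).

Lemma period_pword u : period (pword u) (size u).
Proof. by move=> i; rewrite /pword modnDr. Qed.

Lemma pword_nth u i : i < size u -> pword u i = nth x0 u i.
Proof. by move=> lt_i; rewrite /pword modn_small. Qed.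

Lemma pword_rot k u i : k <= size u -> pword (rot k u) i = pword u (k + i).
Proof.
move=> le_k; rewrite /pword size_rot.
case: (posnP (size u)) => [/size0nil -> | u_gt0].
  by rewrite !nth_nil.
rewrite -modnDmr; have := ltn_pmod i u_gt0; set m := i %% size u => lt_m.
rewrite /rot nth_cat size_drop nth_drop.
case: ltnP => [lt_mk | le_mk]; first by rewrite modn_small //; lia.
rewrite nth_take; last by lia.
have -> : k + m = (m - (size u - k)) + size u by lia.
by rewrite modnDr modn_small //; lia.
Qed.

Lemma eq_from_pword u v : size u = size v -> pword u =1 pword v -> u = v.
Proof.
move=> eq_sz eq_uv; apply: (eq_from_nth (x0 := x0)) => // i lt_i.
by rewrite -!pword_nth -?eq_sz.
Qed.

Lemma rot_period k u : k <= size u -> period (pword u) k -> rot k u = u.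
Proof.
move=> le_k per; apply: eq_from_pword => [|i]; first by rewrite size_rot.
by rewrite pword_rot // addnC per.
Qed.

(** The gcd of [size u] and [p] is a period too; were it smaller than [size u], rotating by it would
    fix [u]. *)
Lemma primitive_period u p :
    0 < size u -> word_primitive u -> period (pword u) p -> size u %| p.
Proof.
move=> u_gt0 /forallP prim per.
have := period_gcdn u_gt0 (@period_pword u) per; set q := gcdn _ _ => perq.
have q_gt0 : 0 < q by rewrite gcdn_gt0 u_gt0.
have : q <= size u by apply: dvdn_leq => //; apply: dvdn_gcdl.
rewrite leq_eqVlt => /predU1P[<-|lt_q]; first exact: dvdn_gcdr.
have := prim (Ordinal lt_q).
by rewrite /= q_gt0 rot_period ?eqxx // ltnW.
Qed.

Variable N : nat.

Definition pkey u k := mkseq (fun i => pword u (k + i)) N.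

(* The [size u] rotations of [u], each repeated periodically up to length [N]. *)
Definition pkeys u := [seq pkey u k | k <- iota 0 (size u)].

Lemma size_pkey u k : size (pkey u k) = N.
Proof. exact: size_mkseq. Qed.

Lemma size_pkeys u : size (pkeys u) = size u.
Proof. by rewrite size_map size_iota. Qed.

Lemma pkey_rot k u i : k <= size u -> pkey (rot k u) i = pkey u (k + i).
Proof. by move=> le_k; apply: eq_mkseq => j; rewrite pword_rot // addnA. Qed.

(** Rotation only shifts the starting points cyclically, so the multiset of keys is an invariant of
    the necklace. *)
Lemma perm_pkeys_rot k u : perm_eq (pkeys (rot k u)) (pkeys u).
Proof.
case: (leqP (size u) k) => [le_uk | /ltnW le_ku]; first by rewrite rot_oversize.
have shift l m :
    [seq pkey u i | i <- iota l m] = [seq pkey u (l + i) | i <- iota 0 m].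
  by rewrite -[l in iota l _]addn0 iotaDl -map_comp.
have -> : pkeys (rot k u) = [seq pkey u i | i <- iota k (size u)].
  rewrite /pkeys size_rot shift; apply: eq_map => i /=; exact: pkey_rot.
have -> : iota k (size u) = iota k (size u - k) ++ iota (size u) k.
  by rewrite -{1}(subnK le_ku) iotaD subnKC.
have -> : pkeys u = [seq pkey u i | i <- iota 0 k ++ iota k (size u - k)].
  by rewrite -iotaD subnKC.
rewrite !map_cat perm_catC perm_cat2r shift (_ : map _ _ = map (pkey u) (iota 0 k)) //.
apply: eq_map => i /=; apply: eq_mkseq => j.
by rewrite -addnA addnC (period_pword u).
Qed.

(** Both periodic words have period [N], so agreement on [N] consecutive letters propagates to all
    of them. *)
Lemma eq_pkey u v k l :
    0 < N -> size u %| N -> size v %| N ->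
  pkey u k = pkey v l -> forall i, pword u (k + i) = pword v (l + i).
Proof.
move=> N_gt0 uN vN eq_uv i.
have pu : period (fun j => pword u (k + j)) N.
  by move=> j; rewrite addnA (period_dvdn uN (@period_pword u)).
have pv : period (fun j => pword v (l + j)) N.
  by move=> j; rewrite addnA (period_dvdn vN (@period_pword v)).
have lt_i : i %% N < N by rewrite ltn_pmod.
move/(congr1 (fun s => nth x0 s (i %% N))): eq_uv; rewrite !nth_mkseq //.
by rewrite (period_modn _ pu) (period_modn _ pv).
Qed.

(** Equal keys at [k <= l] make [l - k] a period, hence a multiple of [size u]; being smaller than
    [size u], it is zero. *)
Lemma uniq_pkeys u :
  0 < N -> size u %| N -> word_primitive u -> uniq (pkeys u).
Proof.
move=> N_gt0 uN prim; rewrite map_inj_in_uniq ?iota_uniq // => k l.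
rewrite !mem_iota !add0n /=.
wlog le_kl : k l / k <= l => [H lt_k lt_l /esym eq_kl|].
  by case/orP: (leq_total k l) => le; [|symmetry]; apply: H.
move=> lt_k lt_l /(eq_pkey N_gt0 uN uN) eq_kl.
have u_gt0 : 0 < size u by apply: leq_ltn_trans lt_k.
have per : period (pword u) (l - k).
  move=> i; rewrite -(period_pword u i) -(period_pword u (i + _)).
  have -> : i + (l - k) + size u = l + (i + (size u - k)) by lia.
  by rewrite -eq_kl; congr pword; lia.
have /dvdn_leq := primitive_period u_gt0 prim per.
by case: (ltngtP k l) le_kl => // lt_kl _ /(_ _); lia.
Qed.

(** If the periodic extensions agree up to a shift, each word has the length of the other as a
    period; by primitivity the lengths divide each other. *)
Lemma pkey_mem u v :
    0 < N -> size u %| N -> size v %| N -> 0 < size u -> 0 < size v ->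
    word_primitive u -> word_primitive v ->
  reflect (exists k, rot k v = u) (pkey u 0 \in pkeys v).
Proof.
move=> N_gt0 uN vN u_gt0 v_gt0 pu pv.
apply: (iffP mapP) => [[k] | [k <-]].
  rewrite mem_iota add0n => /andP[_ lt_k] /(eq_pkey N_gt0 uN vN) eq_uv.
  have peru : period (pword u) (size v).
    by move=> i; rewrite -(add0n i) -(add0n (_ + _)) !eq_uv addnA (period_pword v).
  have perv : period (pword v) (size u).
    move=> i; rewrite -(period_pword v i) -(period_pword v (i + _)).
    have -> : i + size v = k + (i + (size v - k)) by lia.
    have -> : i + size u + size v = k + (i + (size v - k) + size u) by lia.
    by rewrite -!eq_uv !add0n (period_pword u).
  exists k; apply/esym/eq_from_pword => [|i]; last first.
    by rewrite (pword_rot _ (ltnW lt_k)) -[i in LHS]add0n.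
  apply/eqP; rewrite size_rot eqn_dvd.
  apply/andP; split; first exact: primitive_period peru.
  exact: primitive_period perv.
case: (leqP (size v) k) => [le_k | lt_k].
  by exists 0; rewrite ?mem_iota // rot_oversize.
by exists k; rewrite ?mem_iota // pkey_rot ?addn0 // ltnW.
Qed.

Lemma count_pkeys (u v : nword T) :
    0 < N -> size (val u) %| N -> size (val v) %| N ->
    word_primitive (val u) -> word_primitive (val v) ->
  count_mem (pkey (val u) 0) (pkeys (val v))
    = (\pi_(necklace T) v == \pi_(necklace T) u).
Proof.
move=> N_gt0 uN vN pu pv; rewrite count_uniq_mem ?uniq_pkeys //.
congr nat_of_bool; apply/pkey_mem/necklaceP => //.
- exact: valP u.
- exact: valP v.
Qed.

End PeriodicWords.

(** * The standard permutation as an order on positions *)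

Section Standardization.
Variables (d : Order.disp_t) (T : orderType d) (n : nat).
Implicit Type w : n.-tuple T.

(** A strict increase in the order by letter, then position, makes the sets counted by [st_rank]
    strictly included; totality of that order gives the converse. *)
Lemma leq_st w i j :
  (st w i <= st w j)
    = (tnth w i < tnth w j)%O || ((tnth w i == tnth w j) && (i <= j)).
Proof.
suff {i j} lt_st k l : (tnth w k < tnth w l)%O || ((tnth w k == tnth w l) && (k < l)) ->
    st w k < st w l.
  apply/idP/idP => [le_ij | /orP[lt_ij | /andP[eq_ij]]].
  - apply: contraTT le_ij; rewrite negb_or negb_and -ltnNge -leNgt -ltnNge.
    move=> /andP[le_ji nle_ij]; apply: lt_st.
    by move: nle_ij; rewrite [_ == tnth w i]eq_sym; case: ltgtP le_ji.
  - by apply/ltnW/lt_st; rewrite lt_ij.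
  - rewrite leq_eqVlt => /predU1P[/val_inj-> // | lt_ij].
    by apply/ltnW/lt_st; rewrite eq_ij lt_ij orbT.
move=> lt_kl; rewrite -ltnS !stE !st_rankE.
apply/proper_card/properP; split; last first.
  exists l; rewrite !inE ?eqxx ?leqnn ?orbT //.
  rewrite negb_or negb_and -leNgt -ltnNge.
  by case: (ltgtP (tnth w k) (tnth w l)) lt_kl; rewrite ?orbT ?orbF.
apply/subsetP => j; rewrite !inE.
case/orP: lt_kl => [lt_kl|/andP[/eqP eq_kl lt_kl]].
  case/orP => [lt_jk|/andP[_ /eqP->]]; first by rewrite (lt_trans lt_jk).
  by rewrite lt_kl.
case/orP => [lt_jk|/andP[le_jk /eqP->]]; first by rewrite -eq_kl lt_jk.
by rewrite eq_kl eqxx (leq_trans le_jk (ltnW lt_kl)) orbT.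
Qed.

(** Under these conditions the positions counted by the rank of [i] are the [j] with [s j <= s i],
    and there are [(s i).+1] of them. *)
Lemma st_eq w (s : 'S_n) :
    (forall i j, s i < s j -> (tnth w i <= tnth w j)%O) ->
    (forall i j, s i < s j -> tnth w i = tnth w j -> i < j) ->
  st w = s.
Proof.
move=> le_w lt_s; apply/permP => i; apply/val_inj/succn_inj.
rewrite /= stE st_rankE.
transitivity #|[set j | s j <= s i]|.
  apply: eq_card => j; rewrite !inE; case: (ltngtP (s j) (s i)) => [lt_ji|lt_ij|].
  - have := lt_s _ _ lt_ji; have := le_w _ _ lt_ji; rewrite le_eqVlt.
    by case/predU1P=> [-> /(_ erefl)/ltnW-> | -> //]; rewrite eqxx orbT.
  - have := lt_s _ _ lt_ij; have := le_w _ _ lt_ij; rewrite le_eqVlt.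
    case/predU1P=> [eq_ij /(_ eq_ij)|lt_w _].
      by rewrite eq_ij ltxx eqxx andbT ltnNge => /negPf->.
    by rewrite lt_gtF // (gt_eqF lt_w) andbF.
  - by move/val_inj/perm_inj => ->; rewrite leqnn eqxx orbT.
rewrite -(card_imset _ (@perm_inj _ s)).
have -> : [set s j | j in [set j | s j <= s i]] = [set k : 'I_n | k <= s i].
  apply/setP => k; rewrite inE; apply/imsetP/idP => [[j] | le_k].
    by rewrite inE => le_j ->.
  by exists ((s^-1)%g k); rewrite ?inE permKV.
have := ltn_ord (s i); move: (val (s i)) => m lt_m.
by rewrite -sum1dep_card (big_ord_narrow lt_m) sum1_card card_ord.
Qed.

End Standardization.

(** * Words read along the cycles, and counting over [U w] *)

Section CycleWords.
Variables (d : Order.disp_t) (T : orderType d) (x0 : T) (n : nat).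
Variable w : n.-tuple T.
Let sigma : 'S_n := ((st w)^-1)%g.
Let N := n`!.

Definition orbit_key i := [seq tnth w k | k <- traject sigma i N].

Lemma size_cycle_word i : size (cycle_word w i) = #|porbit sigma i|.
Proof. by rewrite size_map size_traject. Qed.

Lemma pword_cycle_word i j :
  pword x0 (cycle_word w i) j = tnth w (iter j sigma i).
Proof.
rewrite /pword size_cycle_word; set m := #|_|.
have m_gt0 : 0 < m by rewrite /m -size_cycle_word cycle_word_gt0.
have lt_j := ltn_pmod j m_gt0.
rewrite (nth_map i) ?size_traject // nth_traject //; congr tnth.
have per : period (fun k => iter k sigma i) m.
  by move=> k; rewrite iterD iter_porbit.
by rewrite (period_modn _ per).
Qed.

Lemma pkey_cycle_word i k :
  pkey x0 N (cycle_word w i) k = orbit_key (iter k sigma i).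
Proof.
apply: (eq_from_nth (x0 := x0)) => [|j].
  by rewrite size_pkey size_map size_traject.
rewrite size_pkey => lt_j.
rewrite nth_mkseq // pword_cycle_word /orbit_key.
rewrite (nth_map (iter k sigma i)) ?size_traject //.
by rewrite nth_traject // addnC iterD.
Qed.

Lemma pkeys_cycle_word i :
  pkeys x0 N (cycle_word w i)
    = [seq orbit_key j | j <- traject sigma i #|porbit sigma i|].
Proof.
rewrite /pkeys size_cycle_word.
have -> : traject sigma i #|porbit sigma i|
    = [seq iter k sigma i | k <- iota 0 #|porbit sigma i|].
  apply: (eq_from_nth (x0 := i)) => [|j]; rewrite size_traject.
    by rewrite size_map size_iota.
  by move=> lt_j; rewrite nth_traject // (nth_map 0) ?size_iota // nth_iota.
by rewrite -map_comp; apply: eq_map => k; rewrite /= pkey_cycle_word.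
Qed.

Lemma primitive_cycle_word i : word_primitive (cycle_word w i).
Proof.
apply/forallP => -[p /= lt_p]; apply/implyP => p_gt0; apply/eqP => rot_p.
have per q : tnth w (iter (p + q) sigma i) = tnth w (iter q sigma i).
  by rewrite -!pword_cycle_word -pword_rot ?rot_p // ltnW.
(* i and sigma^p i carry the same letters along their orbits, so sigma preserves
   their order; the iterates of sigma^p on i are then monotone and periodic. *)
have le_iter q : (iter q sigma i <= iter (p + q) sigma i) = (i <= iter p sigma i).
  elim: q => [|q <-]; first by rewrite addn0.
  rewrite -[iter q _ _](permKV (st w)) -[iter (p + q) _ _](permKV (st w)).
  by rewrite leq_st -!iterS -addnS per ltxx eqxx.
have ge_iter q : (iter (p + q) sigma i <= iter q sigma i) = (iter p sigma i <= i).
  elim: q => [|q <-]; first by rewrite addn0.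
  rewrite -[iter q _ _](permKV (st w)) -[iter (p + q) _ _](permKV (st w)).
  by rewrite leq_st -!iterS -addnS per ltxx eqxx.
have fix_p : iter p sigma i = i.
  set m := #|porbit sigma i|.
  have m_gt0 : 0 < m by rewrite /m -size_cycle_word cycle_word_gt0.
  (* As [m] is the cycle length, [m * p] steps return to [i]; [m.-1.+1] writes [m] as a successor to
     match [H] below. *)
  have itm : iter (m.-1.+1 * p) sigma i = i.
    rewrite prednK // mulnC; elim: (p) => // q IHq.
    by rewrite mulSn addnC iterD iter_porbit.
  apply/val_inj/eqP; rewrite eqn_leq /=.
  case/orP: (leq_total i (iter p sigma i)) => le_i; rewrite le_i ?andbT /=.
    have H q : iter p sigma i <= iter (q.+1 * p) sigma i.
      by elim: q => [|q IHq]; rewrite ?mul1n // mulSn (leq_trans IHq) // le_iter.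
    by have := H m.-1; rewrite itm.
  have H q : iter (q.+1 * p) sigma i <= iter p sigma i.
    by elim: q => [|q IHq]; rewrite ?mul1n // mulSn (leq_trans _ IHq) // ge_iter.
  by have := H m.-1; rewrite itm.
move: lt_p; rewrite size_cycle_word => lt_p.
(* The points of one turn of the cycle are distinct and [p] is less than its length, so [fix_p]
   forces [p = 0]. *)
have := uniq_traject_porbit sigma i => /uniqP-/(_ i 0 p).
rewrite !inE size_traject !nth_traject ?fix_p //=; last by apply: leq_trans lt_p.
by move=> /(_ (leq_trans (ltn0Sn _) lt_p) lt_p erefl) eq_p; rewrite -eq_p in p_gt0.
Qed.

Lemma primitive_cycle_necklace i : necklace_primitive (cycle_necklace w i).
Proof. by rewrite necklace_primitiveE primitive_cycle_word. Qed.

Lemma mem_U x : x \in U w -> exists i, x = cycle_necklace w i.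
Proof.
rewrite (perm_mem (perm_eq_seq_mset _)) mem_pmap => /mapP[C _].
by case: pickP => //= i _ [->]; exists i.
Qed.

Lemma primitive_U : all (@necklace_primitive T) (U w).
Proof. by apply/allP => x /mem_U[i ->]; apply: primitive_cycle_necklace. Qed.

Lemma sum_U (F : necklace T -> nat) (G : {set 'I_n} -> nat) :
    (forall i, F (cycle_necklace w i) = G (porbit (st w) i)) ->
  \sum_(x <- U w) F x = \sum_(C in porbits (st w)) G C.
Proof.
move=> FG; rewrite (perm_big _ (perm_eq_seq_mset _)) big_pmap big_enum /=.
apply: eq_bigr => _ /imsetP[i _ ->].
case: pickP => [j|/(_ i)]; last by rewrite porbit_id.
by rewrite -eq_porbit_mem /= FG => /eqP->.
Qed.

(** The cycles partition the positions; letter counts, key counts and total length of [U w] all come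
    from this. *)
Lemma sum_U_letters (F : necklace T -> nat) (f : 'I_n -> nat) :
    (forall i, F (cycle_necklace w i) = \sum_(j in porbit sigma i) f j) ->
  \sum_(x <- U w) F x = \sum_i f i.
Proof.
move=> Ff; rewrite (sum_U (G := fun C => \sum_(j in C) f j)); last first.
  by move=> i; rewrite Ff porbitV.
rewrite [RHS](partition_big (porbit (st w)) [in porbits (st w)]) /=; last first.
  by move=> i _; apply: imset_f.
apply: eq_bigr => _ /imsetP[i _ ->]; apply: eq_bigl => j.
by rewrite eq_porbit_mem.
Qed.

Lemma big_traject_porbit (f : 'I_n -> nat) i :
  \sum_(j <- traject sigma i #|porbit sigma i|) f j = \sum_(j in porbit sigma i) f j.
Proof.
rewrite big_uniq ?uniq_traject_porbit //=.
by apply: eq_bigl => j; rewrite porbit_traject.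
Qed.

Lemma count_U c : \sum_(x <- U w) necklace_count c x = count_mem c w.
Proof.
rewrite (sum_U_letters (f := fun i => tnth w i == c)).
  by rewrite -sum1_count big_tuple [RHS]big_mkcond.
move=> i; rewrite necklace_countE -big_traject_porbit /=.
by rewrite -sum1_count big_map big_mkcond.
Qed.

Lemma count_keys_U s :
  \sum_(x <- U w) count_mem s (pkeys x0 N (val (repr x)))
    = count_mem s (map orbit_key (enum 'I_n)).
Proof.
rewrite (sum_U_letters (f := fun i => orbit_key i == s)).
  by rewrite -sum1_count big_map big_enum_cond /= [RHS]big_mkcond.
move=> i; rewrite -big_traject_porbit.
transitivity (count_mem s (pkeys x0 N (cycle_word w i))).
  have [k ->] := repr_necklace (exist _ (cycle_word w i) (cycle_word_gt0 w i) : nword T).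
  exact/seq.permP/perm_pkeys_rot.
by rewrite pkeys_cycle_word -sum1_count big_map big_mkcond.
Qed.

Lemma orbit_key_lexi (i j : 'I_n) : i <= j ->
  (orbit_key (sigma i) <= orbit_key (sigma j) :> seqlexi T)%O.
Proof.
(* The number of letters read is generalized from [N]: on a tie of first letters [leq_st] gives
   [sigma i <= sigma j], and the induction continues from there. *)
rewrite /orbit_key; elim: (N) i j => [|m IHm] i j le_ij //=.
have := leq_st w (sigma i) (sigma j); rewrite !permKV le_ij.
rewrite lexi_cons; case: ltgtP => //= _ /esym; apply: IHm.
Qed.

Lemma dvdn_porbit i : #|porbit sigma i| %| N.
Proof.
rewrite dvdn_fact // -size_cycle_word cycle_word_gt0 size_cycle_word.
by rewrite -[X in _ <= X]card_ord max_card.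
Qed.

(** Every cycle length divides [N], so [N - 1] further steps from [sigma i] end at [i]. *)
Lemma last_orbit_key i : last x0 (orbit_key (sigma i)) = tnth w i.
Proof.
have N_gt0 : 0 < N by apply: fact_gt0.
have itN : iter N sigma i = i.
  have per : period (fun k => iter k sigma i) #|porbit sigma i|.
    by move=> k; rewrite iterD iter_porbit.
  by rewrite -[N]add0n (period_dvdn (dvdn_porbit i) per).
rewrite -nth_last /orbit_key size_map size_traject.
rewrite (nth_map (sigma i)) ?size_traject ?ltn_predL //.
by rewrite nth_traject ?ltn_predL // -iterSr prednK ?itN.
Qed.

End CycleWords.

(** * Sorted enumerations and lexicographic order *)

Lemma last_rot1 (T : Type) (x0 : T) s : last x0 (rot 1 s) = nth x0 s 0.
Proof. by case: s => // x s; rewrite rot1_cons last_rcons. Qed.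

Lemma nth_rot1 (T : Type) (x0 : T) s i :
  i.+1 < size s -> nth x0 (rot 1 s) i = nth x0 s i.+1.
Proof. by case: s => // x s lt_i; rewrite rot1_cons nth_rcons -ltnS lt_i. Qed.

Lemma sorted_map_ord (d : Order.disp_t) (T : porderType d) n (f : 'I_n -> T) :
    (forall i j : 'I_n, i <= j -> (f i <= f j)%O) ->
  sorted <=%O (map f (enum 'I_n)).
Proof.
move=> f_homo; rewrite sorted_map.
apply: (sub_sorted (e := relpre val leq)) => [i j|]; first exact: f_homo.
by rewrite -sorted_map val_enum_ord iota_sorted.
Qed.

(** Uniqueness of sorting; both the injectivity and the surjectivity of [U] rest on it. *)
Lemma homo_ord_perm_eq (d : Order.disp_t) (T : porderType d) n (f g : 'I_n -> T) :
    (forall i j : 'I_n, i <= j -> (f i <= f j)%O) ->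
    (forall i j : 'I_n, i <= j -> (g i <= g j)%O) ->
    perm_eq (map f (enum 'I_n)) (map g (enum 'I_n)) ->
  f =1 g.
Proof.
move=> /sorted_map_ord sf /sorted_map_ord sg.
move/(sorted_eq le_trans le_anti sf sg) => eq_fg i.
by move/eq_in_map: eq_fg; apply; rewrite mem_enum.
Qed.

Lemma perm_map_perm (T : eqType) n (f : 'I_n -> T) (s : 'S_n) :
  perm_eq (map (f \o s) (enum 'I_n)) (map f (enum 'I_n)).
Proof.
rewrite map_comp perm_map // uniq_perm ?enum_uniq //.
  by rewrite map_inj_uniq ?enum_uniq //; apply: perm_inj.
move=> i; rewrite mem_enum; apply/mapP; exists ((s^-1)%g i).
  by rewrite mem_enum.
by rewrite permKV.
Qed.

(** Equal lengths are essential: otherwise the shorter word could be a proper prefix of the other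
    one once the last letters are gone. *)
Lemma lexi_rcons (d : Order.disp_t) (T : orderType d) (s t : seq T) x y :
  size s = size t -> (rcons s x <= rcons t y :> seqlexi T)%O ->
  (s <= t :> seqlexi T)%O.
Proof.
elim: s t => [|a s IHs] [|b t] //= [/IHs{}IHs].
by rewrite !lexi_cons => /andP[-> /implyP H]; apply/implyP => /H.
Qed.

(** * The multiset of keys of a multiset of necklaces *)

Section KeysOfMultisets.
Variables (T : choiceType) (x0 : T) (n : nat).
Implicit Type M : {mset necklace T}.

Definition mset_keys M := flatten [seq pkeys x0 n`! (val (repr x)) | x <- M].

Lemma count_mset_keys M s :
  count_mem s (mset_keys M)
    = \sum_(x <- M) count_mem s (pkeys x0 n`! (val (repr x))).
Proof. by rewrite count_flatten -map_comp sumnE big_map. Qed.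

Lemma dvdn_necklace_size M x :
  \sum_(y <- M) necklace_size y = n -> x \in M -> necklace_size x %| n`!.
Proof.
move=> <- Mx; apply: dvdn_fact; rewrite (valP (repr x)).
by rewrite (big_rem x) //= leq_addr.
Qed.

Lemma mset_keys_inj M M' :
    all (@necklace_primitive T) M -> all (@necklace_primitive T) M' ->
    \sum_(x <- M) necklace_size x = n -> \sum_(x <- M') necklace_size x = n ->
    perm_eq (mset_keys M) (mset_keys M') ->
  M = M'.
Proof.
move=> pM pM' sM sM' /seq.permP eq_keys; apply/msetP => x.
(* A primitive necklace has each of its keys once and shares none with other primitive necklaces, so
   one key of [x] counts the copies of [x]. *)
have mult M1 : all (@necklace_primitive T) M1 ->
    \sum_(y <- M1) necklace_size y = n ->
    necklace_primitive x -> necklace_size x %| n`! ->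
    M1 x = count_mem (pkey x0 n`! (val (repr x)) 0) (mset_keys M1).
  move=> /allP pM1 sM1 px xN; rewrite count_mset_keys.
  rewrite -{1}(seq_mset_id M1) mset_seqE -sum1_count big_mkcond /=.
  apply: eq_big_seq => y M1y.
  rewrite count_pkeys ?fact_gt0 //.
  - by rewrite !reprK; case: eqP.
  - exact: dvdn_necklace_size M1y.
  - exact: pM1.
(* Primitivity of [x] and the divisibility of [n!] are known only for members; outside both
   multisets the multiplicities vanish. *)
have [Mx|] := boolP (x \in M).
  have := allP pM x Mx => px; have xN := dvdn_necklace_size sM Mx.
  by rewrite !mult // eq_keys.
have [M'x _|] := boolP (x \in M').
  have := allP pM' x M'x => px; have xN := dvdn_necklace_size sM' M'x.
  by rewrite !mult // eq_keys.
by rewrite -!mset_eq0 => /eqP-> /eqP->.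
Qed.

(** A key covers a whole number of periods, so rotating it by one letter is the same as starting it
    one letter later. *)
Lemma map_rot_pkeys N u :
  size u %| N -> 0 < size u -> map (rot 1) (pkeys x0 N u) = pkeys x0 N (rot 1 u).
Proof.
move=> uN u_gt0; rewrite /pkeys size_rot -map_comp; apply: eq_map => k /=.
rewrite pkey_rot // add1n; case: N uN => [|N] uN //.
apply: (eq_from_nth (x0 := x0)) => [|i]; first by rewrite size_rot !size_pkey.
rewrite size_rot size_pkey => lt_i; rewrite nth_mkseq //.
rewrite -{1}(@pword_nth _ x0) ?size_rot ?size_pkey // pword_rot ?size_pkey //.
rewrite /pword size_pkey nth_mkseq ?ltn_pmod //.
have per : period (pword x0 u) N.+1 by apply: period_dvdn uN (@period_pword _ _ _).
change (pword x0 u (k + (1 + i) %% N.+1) = pword x0 u (k.+1 + i)).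
rewrite -(period_modn _ per) modnDmr (period_modn _ per); congr pword; lia.
Qed.

Lemma perm_map_rot_mset_keys M :
    \sum_(x <- M) necklace_size x = n ->
  perm_eq (map (rot 1) (mset_keys M)) (mset_keys M).
Proof.
(* The divisibility is recorded element by element because the condition on the total size does not
   pass to sublists. *)
move=> sM; have : {in (M : seq _), forall x, necklace_size x %| n`!}.
  by move=> x Mx; apply: (dvdn_necklace_size sM).
rewrite /mset_keys; elim: (M : seq _) => //= x s IHs Ms.
rewrite map_cat; apply: perm_cat.
  rewrite map_rot_pkeys ?perm_pkeys_rot //; first by apply: Ms; apply: mem_head.
  exact: valP (repr x).
by apply: IHs => y sy; apply: Ms; rewrite inE sy orbT.
Qed.

End KeysOfMultisets.

(** * Injectivity and surjectivity of [U] *)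

Section Bijectivity.
Variables (d : Order.disp_t) (T : orderType d) (x0 : T) (n : nat).
Implicit Types (w : n.-tuple T) (M : {mset necklace T}).

Lemma necklace_size_U w : \sum_(x <- U w) necklace_size x = n.
Proof.
rewrite (sum_U_letters (f := fun=> 1)); first by rewrite sum1_card card_ord.
by move=> i; rewrite necklace_sizeE size_cycle_word sum1_card.
Qed.

Lemma num_necklaces_U w j : num_necklaces (U w) j = num_cycles (st w) j.
Proof.
rewrite /num_necklaces /num_cycles -sum1_count -sum1_card big_mkcond /=.
rewrite (sum_U (G := fun C => if #|C| == j then 1 else 0)); last first.
  by move=> i; rewrite necklace_sizeE size_cycle_word porbitV.
by rewrite -big_mkcondr; apply: eq_bigl => C; rewrite inE.
Qed.

Lemma perm_mset_keys_U w :
  perm_eq (mset_keys x0 n (U w)) (map (orbit_key w \o (st w)^-1%g) (enum 'I_n)).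
Proof.
rewrite perm_sym (perm_trans (perm_map_perm _ _)) //.
by apply/allP => s _; rewrite /=  count_mset_keys count_keys_U.
Qed.

Lemma U_inj : injective (@U d T n).
Proof.
move=> w w' eq_U.
have eq_keys : orbit_key w \o (st w)^-1%g =1 orbit_key w' \o (st w')^-1%g.
  apply: (@homo_ord_perm_eq _ (seqlexi T)).
  - by move=> i j; apply: orbit_key_lexi.
  - by move=> i j; apply: orbit_key_lexi.
  - have := perm_mset_keys_U w; rewrite perm_sym => /perm_trans; apply.
    by rewrite eq_U perm_mset_keys_U.
apply: eq_from_tnth => i.
by rewrite -!(last_orbit_key x0) [orbit_key _ _]eq_keys.
Qed.

Lemma U_surj M :
    all (@necklace_primitive T) M -> \sum_(x <- M) necklace_size x = n ->
  exists w, U w = M.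
Proof.
move=> pM sM.
have allsz s : s \in mset_keys x0 n M -> size s = n`!.
  case/flatten_mapP => x _ /mapP[k _ ->]; exact: size_pkey.
have size_keys : size (mset_keys x0 n M) = n.
  rewrite size_flatten /shape -map_comp sumnE big_map -[RHS]sM.
  by apply: eq_bigr => x _; rewrite /= size_pkeys.
pose S := sort <=%O (mset_keys x0 n M : seq (seqlexi T)).
have size_S : size S = n by rewrite size_sort.
pose f (i : 'I_n) : seqlexi T := nth [::] S i.
have perm_f : perm_eq (map f (enum 'I_n)) (mset_keys x0 n M).
  have -> : map f (enum 'I_n) = S.
    rewrite -[RHS](mkseq_nth ([::] : seqlexi T)) size_S /mkseq -val_enum_ord.
    by rewrite -map_comp.
  by rewrite perm_sort.
have size_f i : size (f i) = n`!.
  by apply: allsz; rewrite -(perm_mem perm_f) map_f ?mem_enum.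
have homo_f (i j : 'I_n) : i <= j -> (f i <= f j)%O.
  move=> le_ij; apply: le_sorted_leq_nth => //; rewrite ?inE ?size_S //.
  by apply: sort_sorted; apply: le_total.
pose w := [tuple last x0 (f i) | i < n].
have wE i : tnth w i = last x0 (f i) by rewrite tnth_mktuple.
pose sigma := ((st w)^-1)%g.
(* The words [rotr 1 (f (sigma i))] increase with [i]: [sigma] lists positions by last letter of
   [f], then by position, along which [f] increases. They form the same multiset, closed under
   rotation, hence agree with [f]. *)
have f_rotr : f =1 (rotr 1 \o f) \o sigma.
  apply: homo_ord_perm_eq => //.
  - move=> i j; have := leq_st w (sigma i) (sigma j); rewrite !permKV => -> /=.
    rewrite !wE; have := homo_f (sigma i) (sigma j).
    have := size_f (sigma i); have := size_f (sigma j).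
    case/lastP: (f (sigma i)) => [|s x].
      by move=> _ /esym; have := fact_gt0 n; case: n`!.
    case/lastP: (f (sigma j)) => [|t y].
      by move=> /esym; have := fact_gt0 n; case: n`!.
    rewrite !rotr1_rcons !last_rcons !size_rcons lexi_cons => <- [eq_sz] le_f.
    by case: ltgtP => //= _ /le_f; apply: lexi_rcons.
  - rewrite perm_sym (perm_trans (perm_map_perm _ _)) // map_comp.
    have := perm_trans (perm_map (rot 1) perm_f) (perm_map_rot_mset_keys x0 sM).
    move=> perm_rot; have := perm_f; rewrite perm_sym.
    move=> /(perm_trans perm_rot)/(perm_map (rotr 1)).
    by rewrite (mapK (rotK _)) perm_sym.
have f_rot i : f (sigma i) = rot 1 (f i) by rewrite [f i]f_rotr /= rotrK.
(* By [f_rot], letter [j.+1] of [f i] is letter [j] of [f (sigma i)], and the first letter of [f i]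
   is the last one of [f (sigma i)], that is [w] at [sigma i]. *)
have fE i : f i = orbit_key w (sigma i).
  apply: (eq_from_nth (x0 := x0)) => [|j].
    by rewrite size_f size_map size_traject.
  rewrite size_f => lt_j; rewrite /orbit_key.
  rewrite (nth_map (sigma i)) ?size_traject // nth_traject // -/sigma.
  elim: j i lt_j => [|j IHj] i lt_j.
    by rewrite wE f_rot last_rot1.
  by rewrite iterSr -(IHj _ (ltnW lt_j)) f_rot nth_rot1 ?size_f.
exists w; apply: (mset_keys_inj (x0 := x0)) pM _ sM _ => //.
- exact: primitive_U.
- exact: necklace_size_U.
apply: perm_trans (perm_mset_keys_U w) _.
rewrite (_ : map _ _ = map f (enum 'I_n)) //.
by apply: eq_map => i; rewrite fE.
Qed.

End Bijectivity.

(** * Increasing words of given content and descent sets *)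

Section Blocks.
Variables (n a : nat) (r : 'I_a -> nat).
Implicit Types (w u v : n.-tuple 'I_a) (s : 'S_n).

Definition word_perm w s := [tuple tnth w (s i) | i < n].

Lemma word_perm_content w s : word_content r (word_perm w s) = word_content r w.
Proof.
apply: eq_forallb => c; congr (_ == _); apply/seq.permP.
rewrite -[X in perm_eq _ X]map_tnth_enum; apply: perm_map_perm.
Qed.

(** In a sorted word the letters up to [c] form a prefix, whose length is the partial sum at [c]. *)
Lemma sorted_tnth_leq u (c : 'I_a) (i : 'I_n) :
    sorted <=%O u -> word_content r u ->
  (tnth u i <= c)%O = (i < \sum_(b < a | b <= c) r b).
Proof.
move=> u_sorted /forallP u_r.
have -> : \sum_(b < a | b <= c) r b = count (<= c)%O u.
  rewrite -sum1_count [RHS](partition_big id (fun b => (b <= c)%O)) //=.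
  apply: eq_bigr => b le_bc; rewrite -(eqP (u_r b)) -sum1_count.
  by apply: eq_bigl => x /=; case: eqP => [->|]; rewrite ?andbF // andbT.
rewrite (tnth_nth c); apply/idP/idP; last exact: nth_count_le.
apply: contraLR; rewrite -leqNgt -ltNge => le_i.
by apply: nth_count_gt => //; rewrite le_i size_tuple ltn_ord.
Qed.

Lemma sorted_tupleP u :
  reflect (forall i j : 'I_n, i <= j -> (tnth u i <= tnth u j)%O) (sorted <=%O u).
Proof.
apply: (iffP idP) => [u_sorted i j le_ij | u_homo]; last first.
  by rewrite -[tval u]map_tnth_enum sorted_map_ord.
pose c := tnth u i; rewrite (tnth_nth c u i) (tnth_nth c u j).
apply: le_sorted_leq_nth => //;
  by rewrite inE size_tuple.
Qed.

Lemma sorted_word_perm_st w : sorted <=%O (word_perm w (st w)^-1%g).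
Proof.
apply/sorted_tupleP => i j le_ij; rewrite !tnth_mktuple.
have := leq_st w ((st w)^-1%g i) ((st w)^-1%g j); rewrite !permKV le_ij.
by move/esym/orP => [/ltW | /andP[/eqP->]].
Qed.

Lemma sorted_content_uniq u v :
    sorted <=%O u -> sorted <=%O v -> word_content r u -> word_content r v ->
  u = v.
Proof.
move=> su sv /forallP ur /forallP vr; apply/val_inj.
apply: (sorted_eq le_trans le_anti su sv); apply/allP => c _ /=.
by rewrite (eqP (ur c)) (eqP (vr c)).
Qed.

Lemma sorted_content_ex :
  \sum_(i < a) r i = n ->
  exists2 u : n.-tuple 'I_a, sorted <=%O u & word_content r u.
Proof.
move=> hr; pose t := sort <=%O (flatten [seq nseq (r c) c | c <- enum 'I_a]).
have size_t : size t == n.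
  rewrite size_sort size_flatten /shape -map_comp sumnE big_map big_enum -hr.
  by apply/eqP/eq_bigr => c _; rewrite /= size_nseq.
exists (Tuple size_t); first by apply: sort_sorted; apply: le_total.
apply/forallP => c; rewrite /= (seq.permP (permEl (perm_sort _ _))) count_flatten.
rewrite -map_comp sumnE big_map big_enum (bigD1 c) //= count_nseq /= eqxx mul1n.
by rewrite big1 ?addn0 // => b /negPf b_c; rewrite count_nseq /= b_c.
Qed.

Lemma descent_set_st w :
  0 < a -> \sum_(i < a) r i = n -> word_content r w ->
  descent_set (st w)^-1%g \subset partial_sums n r.
Proof.
move=> a_gt0 hr wr; set s := (st w)^-1%g.
apply/subsetP => p; rewrite !inE => /orP[/eqP eq_p|].
  (* The conventional descent at [n] is the partial sum at the largest letter. *)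
  have lt_a : a.-1 < a by rewrite prednK.
  apply/existsP; exists (Ordinal lt_a); rewrite eq_p -[X in X == _]hr.
  by apply/eqP/eq_bigl => c /=; rewrite -ltnS prednK ?ltn_ord.
case/existsP => i /existsP[j /and3P[/eqP eq_i /eqP eq_j lt_s]].
(* A descent of [s] rules out a tie, so [u] jumps after [i]; the letters up to [tnth u i] then fill
   exactly [i.+1] places. *)
apply/existsP; pose u := word_perm w s; exists (tnth u i).
have u_sorted := sorted_word_perm_st w.
have ur : word_content r u by rewrite word_perm_content.
have lt_u : (tnth u i < tnth u j)%O.
  have := leq_st w (s i) (s j); rewrite !permKV eq_j -eq_i leqnSn !tnth_mktuple.
  by rewrite [s i <= s j]leqNgt lt_s andbF orbF => <-.
have := sorted_tnth_leq (tnth u i) i u_sorted ur.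
have := sorted_tnth_leq (tnth u i) j u_sorted ur.
rewrite lexx leNgt lt_u eq_j -eq_i /= => /esym/negbT; rewrite -leqNgt.
by move=> le_i /esym lt_i; rewrite eqn_leq le_i lt_i.
Qed.

(** No partial sum falls strictly inside a block of equal letters, so [s] has no descent there. *)
Lemma descent_perm_mono s u (i j : 'I_n) :
    descent_set s \subset partial_sums n r ->
    sorted <=%O u -> word_content r u ->
  i < j -> tnth u i = tnth u j -> s i < s j.
Proof.
move=> sub_s u_sorted ur; case: j => j lt_j; elim: j lt_j => //= j IHj lt_j.
move=> lt_ij eq_ij; pose j' := Ordinal (ltnW lt_j).
have u_homo := elimT (sorted_tupleP u) u_sorted.
have eq_u : tnth u j' = tnth u (Ordinal lt_j).
  by apply/le_anti; rewrite u_homo //= -eq_ij u_homo.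
have lt_s : s j' < s (Ordinal lt_j).
  rewrite ltn_neqAle val_eqE (inj_eq perm_inj) -val_eqE /= neq_ltn ltnSn /=.
  rewrite leqNgt; apply/negP => gt_s.
  have lt_p : j.+1 < n.+1 by rewrite ltnS ltnW.
  have /(subsetP sub_s) : Ordinal lt_p \in descent_set s.
    rewrite inE; apply/orP; right; apply/existsP; exists j'.
    by apply/existsP; exists (Ordinal lt_j); rewrite /= !eqxx.
  (* The descent position [j.+1] would be the length of the prefix of letters up to [c], separating
     [j'] from its successor although their letters agree. *)
  rewrite inE => /existsP[c /eqP /= eq_p].
  have := sorted_tnth_leq c j' u_sorted ur.
  by rewrite eq_u (sorted_tnth_leq c _ u_sorted ur) -eq_p /= ltnn ltnSn.
move: lt_ij; rewrite ltnS leq_eqVlt => /predU1P[eq_j | lt_ij].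
  by rewrite (_ : i = j') //; apply: val_inj.
by apply: ltn_trans lt_s; apply: IHj => //; rewrite eq_ij -eq_u.
Qed.

Lemma st_word_perm s u :
    descent_set s \subset partial_sums n r ->
    sorted <=%O u -> word_content r u ->
  st (word_perm u s^-1%g) = (s^-1)%g.
Proof.
move=> sub_s u_sorted ur; apply: st_eq => i j lt_ij; rewrite !tnth_mktuple.
  by move/sorted_tupleP: u_sorted; apply; apply: ltnW.
by move/(descent_perm_mono sub_s u_sorted ur lt_ij); rewrite !permKV.
Qed.

(** Both words become the unique increasing word of content [r] once reordered by the same
    permutation. *)
Lemma st_content_inj w w' :
  word_content r w -> word_content r w' -> st w = st w' -> w = w'.
Proof.
move=> wr wr' eq_st.
have eq_ww : word_perm w (st w)^-1%g = word_perm w' (st w')^-1%g.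
  by apply: sorted_content_uniq;
    rewrite ?sorted_word_perm_st ?word_perm_content.
apply: eq_from_tnth => i; have := congr1 (fun u => tnth u (st w i)) eq_ww.
by rewrite !tnth_mktuple -eq_st permK.
Qed.

End Blocks.

(** * Assembling the bijection *)

Lemma sum_necklace_count (T : finType) (x : necklace T) :
  \sum_(c : T) necklace_count c x = necklace_size x.
Proof.
rewrite /necklace_size -sum1_size [RHS](partition_big id xpredT) //=.
by apply: eq_bigr => c _; rewrite sum1_count.
Qed.

Theorem theorem2 (n a : nat) (hn : 1 <= n) (ha : 1 <= a)
    (r : 'I_a -> nat) (hr : \sum_(i < a) r i = n) :
  (forall pi : descent_perm n r,
     exists! w : n.-tuple 'I_a, word_content r w /\ st w = ((sval pi)^-1)%g) /\
  exists Ubar : descent_perm n r -> primitive_multiset r,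
    [/\ forall (pi : descent_perm n r) (w : n.-tuple 'I_a),
          word_content r w -> st w = ((sval pi)^-1)%g -> sval (Ubar pi) = U w,
        bijective Ubar
      & forall (pi : descent_perm n r) (j : nat), 1 <= j ->
          num_cycles (sval pi) j = num_necklaces (sval (Ubar pi)) j].
Proof.
have x0 : 'I_a := Ordinal ha.
have [u u_sorted ur] := sorted_content_ex hr.
pose word (s : descent_perm n r) := word_perm u (sval s)^-1%g.
have word_r s : word_content r (word s) by rewrite word_perm_content.
have st_word s : st (word s) = (sval s)^-1%g by apply: st_word_perm (valP s) _ _.
have word_uniq s w : word_content r w -> st w = (sval s)^-1%g -> word s = w.
  by move=> wr st_w; apply: (st_content_inj (word_r s) wr); rewrite st_word.
have U_word s : all (@necklace_primitive _) (U (word s)) &&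
    [forall c : 'I_a, \sum_(x <- U (word s)) necklace_count c x == r c].
  apply/andP; split; first exact: primitive_U.
  apply/forallP => c; rewrite count_U.
  by move/forallP: (word_r s).
have surj (M : primitive_multiset r) : exists s, U (word s) == sval M.
  have /andP[pM /forallP Mr] := valP M.
  have sM : \sum_(x <- sval M) necklace_size x = n.
    under eq_bigr do rewrite -sum_necklace_count.
    by rewrite exchange_big -hr; apply: eq_bigr => c _; apply/eqP.
  have [w Uw] := U_surj x0 pM sM.
  have wr : word_content r w by apply/forallP => c; rewrite -count_U Uw.
  pose s : descent_perm n r := exist _ (st w)^-1%g (descent_set_st ha hr wr).
  by exists s; rewrite (word_uniq s w) ?Uw //= invgK.
split.
  move=> s; exists (word s); split=> [|w [wr st_w]]; first by split.
  exact: word_uniq.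
exists (fun s => exist _ (U (word s)) (U_word s)); split.
- by move=> s w wr st_w /=; rewrite (word_uniq s w).
(* The inverse chooses a preimage; it is a left inverse because [U] determines the word and [st] of
   the word is the inverse permutation. *)
- exists (fun M => xchoose (surj M)) => [s | M]; last first.
    by apply/val_inj/eqP; apply: xchooseP (surj M).
  apply/val_inj/invg_inj; rewrite -!st_word; congr st.
  by apply: (U_inj x0); exact: (eqP (xchooseP (surj _))).
- by move=> s j _; rewrite /= num_necklaces_U st_word /num_cycles porbitsV.
Qed.
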